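(* Let $k\geqslant 2$ be an integer and let $n\geqslant\frac{k}{2}$ be a positive integer. For the grid graph $P_2\times P_n$, $$\gamma_{k\text{-SRD}}(P_2\times P_n)=\begin{cases}\left\lceil\dfrac{2kn}{k+1}\right\rceil, & \text{if } n\equiv r \pmod{k+1} \text{ for some integer } r \text{ with } 0<r<\dfrac{k+1}{2},\\[8pt] \left\lceil\dfrac{2kn}{k+1}\right\rceil+1, & \text{otherwise.}\end{cases}$$
   Context: $P_2\times P_n$ is the graph with vertex set $\{a_{i,j} : i\in\{1,2\},\ j\in\{1,\ldots,n\}\}$ and edge set $\{a_{i,j}a_{i,j+1} : i\in\{1,2\},\ j\in\{1,\ldots,n-1\}\}\cup\{a_{1,j}a_{2,j} : j\in\{1,\ldots,n\}\}$. All graphs are finite, simple and undirected; $N(v)$ denotes the set of neighbors of $v$ and $\Delta(G)$ the maximum degree. Let $k\geqslant 1$ be an integer with $|V(G)|\geqslant k$. An attack pattern is a set $P\subseteq V(G)$ with $|P|=k$. A function $f:V(G)\to\{0,1,\ldots,\min(\Delta(G),k)+1\}$ is a proper $k$-SRD ($k$-strong Roman domination) function if for each attack pattern $P$ every vertex $u\in P$ with $f(u)=0$ can be defended by a neighboring vertex, where each vertex $v$ with $f(v)\geqslant 2$ can defend at most $f(v)-1$ of its neighbors in $P$ labeled 0 (and vertices with label $\leqslant 1$ defend no other vertex). That is, for each $P$ there is a map $\delta_P:\{u\in P : f(u)=0\}\to V(G)$ (which may depend on $P$) such that $\delta_P(u)\in N(u)$ and $f(\delta_P(u))\geqslant 2$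 for all $u$ in its domain, and $|\delta_P^{-1}(v)|\leqslant f(v)-1$ for every $v$ with $f(v)\geqslant 2$. The weight is $\omega(f)=\sum_{v\in V(G)}f(v)$, and the $k$-SRD number is $\gamma_{k\text{-SRD}}(G)=\min\{\omega(f) : f \text{ is a proper } k\text{-SRD function on } G\}$. *)

(* Defs.v *)
From mathcomp Require Import all_boot.

Set Implicit Arguments.
Unset Strict Implicit.
Unset Printing Implicit Defensive.

Record sgraph := SGraph {
  vertex :> finType;
  adj : rel vertex;
  adj_sym : symmetric adj;
  adj_irrefl : irreflexive adj
}.

Definition neighbors (G : sgraph) (v : G) : {set G} := [set u | adj v u].

Definition max_degree (G : sgraph) : nat := \max_(v : G) #|neighbors v|.

(* Labelings V(G) -> {0, 1, ..., min(Delta(G), k) + 1}. *)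
Definition labeling (G : sgraph) (k : nat) :=
  {ffun G -> 'I_(minn (max_degree G) k).+2}.

Definition weight (G : sgraph) (k : nat) (f : labeling G k) : nat :=
  \sum_(v : G) f v.

Definition zeros_in (G : sgraph) (k : nat) (f : labeling G k) (P : {set G}) :
    {set G} :=
  [set u in P | f u == 0 :> nat].

(* d is a total function, but only its values on zeros_in f P matter: it
   encodes a map from zeros_in f P to V(G). *)
Definition defends (G : sgraph) (k : nat) (f : labeling G k) (P : {set G})
    (d : {ffun G -> G}) : bool :=
  [forall u in zeros_in f P, (d u \in neighbors u) && (2 <= f (d u))] &&
  [forall (v : G | 2 <= f v), #|[set u in zeros_in f P | d u == v]| <= f v - 1].

Definition proper_kSRD (G : sgraph) (k : nat) (f : labeling G k) : bool :=
  [forall (P : {set G} | #|P| == k), [exists d : {ffun G -> G}, defends f P d]].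

Definition all_ones (G : sgraph) (k : nat) : labeling G k :=
  [ffun=> inord 1].

Lemma all_ones_proper (G : sgraph) (k : nat) : proper_kSRD (all_ones G k).
Proof.
apply/forall_inP => P _; apply/existsP; exists [ffun x => x].
have z0 : zeros_in (all_ones G k) P = set0.
  by apply/setP => u; rewrite !inE ffunE inordK // andbF.
rewrite /defends z0; apply/andP; split; apply/forall_inP => u; rewrite ?inE // => _.
by rewrite (_ : [set _ in _ | _] = set0) ?cards0 //; apply/setP => v; rewrite !inE.
Qed.

(* The minimum is over a nonempty set, since all_ones is always proper; see
   kSRD_number_attained and kSRD_number_min. *)
Definition kSRD_number (G : sgraph) (k : nat) : nat :=
  weight [arg min_(f < all_ones G k | proper_kSRD f) weight f].

Lemma kSRD_number_attained (G : sgraph) (k : nat) :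
  exists2 f : labeling G k, proper_kSRD f & weight f = kSRD_number G k.
Proof.
rewrite /kSRD_number; case: arg_minnP => [|f fP _]; first exact: all_ones_proper.
by exists f.
Qed.

Lemma kSRD_number_min (G : sgraph) (k : nat) (f : labeling G k) :
  proper_kSRD f -> kSRD_number G k <= weight f.
Proof.
rewrite /kSRD_number; case: arg_minnP => [|g _ gmin]; first exact: all_ones_proper.
exact: gmin.
Qed.

(* Vertices are 0-indexed: (i, j) stands for a_{i+1,j+1}.  grid_arc lists each
   edge once, in the orientation a_{i,j} -> a_{i,j+1} or a_{1,j} -> a_{2,j}. *)
Definition grid_arc (n : nat) (u v : 'I_2 * 'I_n) : bool :=
  ((u.1 == v.1) && (v.2 == u.2.+1 :> nat)) ||
  [&& u.1 == 0 :> nat, v.1 == 1 :> nat & u.2 == v.2].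

Definition grid_adj (n : nat) : rel ('I_2 * 'I_n) :=
  fun u v => grid_arc u v || grid_arc v u.

Lemma grid_adj_sym (n : nat) : symmetric (@grid_adj n).
Proof. by move=> u v; rewrite /grid_adj orbC. Qed.

Lemma grid_adj_irrefl (n : nat) : irreflexive (@grid_adj n).
Proof.
move=> [i j]; rewrite /grid_adj /grid_arc /= orbb ltn_eqF // andbF /=.
by case: i => [[|[|i]] hi].
Qed.

Definition grid2 (n : nat) : sgraph :=
  SGraph (@grid_adj_sym n) (@grid_adj_irrefl n).

(* Main.v *)
Require Import Defs.
From mathcomp Require Import all_boot all_order all_algebra.
From mathcomp Require Import zify.

Import Order.TTheory GRing.Theory Num.Theory.

Set Implicit Arguments.
Unset Strict Implicit.
Unset Printing Implicit Defensive.

(** Let [Z] be the set of vertices labeled 0 and [c v = f v - 1]: the labeling is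
    proper iff every [S] in [Z] with at most [k] elements satisfies Hall's condition
    [#|S| <= c (N S)], and its weight is [2n - (#|Z| - c V)].  So the theorem says
    that the largest excess [#|Z| - c V] is [2 (n / (k+1))], minus one if [k+1]
    divides [n].

    Upper bound on the excess.  We may assume that each guard is weaker than the
    number of its zero neighbours.  Sweep the grid from left to right.  Among the
    zeros seen so far, let [lower] be their number minus the strength of all their
    neighbours, and [upper] the same without the guards that still have zero
    neighbours ahead.  Hall's condition says that [lower] cannot exceed an earlier
    value of [upper] as long as at most [k] zeros lie between.  If [lower <= M] up
    to a column then [upper <= M + 2] at the next one, so [lower <= M + 2] for
    [k] more columns.  A column of two zeros would spoil the count of zeros, but
    it either allows a restart between its two zeros, or is balanced by a column
    of two guards next to it.

    Construction.  Checkerboards of [k] columns with labels 0 and 2, separated by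
    columns of two zeros. *)

(** * Hall's condition for proper labelings *)

Definition nbhd (G : sgraph) (S : {set G}) : {set G} :=
  \bigcup_(u in S) neighbors u.

Definition hall (G : sgraph) (k : nat) (Z : {set G}) (c : G -> nat) : Prop :=
  forall S : {set G}, S \subset Z -> #|S| <= k -> #|S| <= \sum_(v in nbhd S) c v.

Lemma extend_set (T : finType) (k : nat) (S : {set T}) :
  #|S| <= k <= #|T| -> exists2 P : {set T}, S \subset P & #|P| = k.
Proof.
case/andP; elim: k => [|k IH] Sk kT.
  by exists S => //; apply/eqP; rewrite -leqn0.
case: (ltngtP #|S| k.+1) Sk => // [lt|eq] _; last by exists S.
have [P SP Pk] := IH lt (ltnW kT).
have /card_gt0P[x xP] : 0 < #|~: P| by rewrite cardsCs setCK; lia.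
exists (x |: P); first exact: subset_trans SP (subsetU1 _ _).
by rewrite cardsU1 -in_setC xP Pk.
Qed.

(** [S] extends to an attack pattern, whose defence splits [S] into fibres over [nbhd S]; the fibre
    over [v] has at most [f v - 1] elements. *)
Lemma hall_of_proper (G : sgraph) (k : nat) (f : labeling G k) :
  k <= #|G| -> proper_kSRD f ->
  hall k [set v | f v == 0 :> nat] (fun v => f v - 1).
Proof.
move=> kG /forall_inP fP S SZ Sk.
have [|P SP Pk] := @extend_set _ k S; first by rewrite Sk.
have /existsP[d /andP[/forall_inP dN /forall_inP dc]] := fP P (introT eqP Pk).
have SzP u : u \in S -> u \in zeros_in f P.
  by move=> uS; move/subsetP/(_ u uS): SZ; rewrite !inE (subsetP SP).
rewrite -sum1_card (partition_big d (mem (nbhd S))) /=; last first.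
  move=> u uS; apply/bigcupP; exists u => //.
  by have /andP[] := dN u (SzP u uS).
apply: leq_sum => v _; rewrite sum1dep_card.
have [->|[u]] := set_0Vmem [set x in S | d x == v]; first by rewrite cards0.
rewrite inE => /andP[uS /eqP duv].
have f2 : 2 <= f v by rewrite -duv; have /andP[] := dN u (SzP u uS).
apply: leq_trans (dc v f2); apply/subset_leq_card/subsetP => w.
by rewrite !inE => /andP[wS ->]; have := SzP w wS; rewrite !inE => ->.
Qed.

(* A guard at least as strong as the number of its zero neighbours can be
   relabelled 1 together with these neighbours, at no loss. *)
Lemma hall_normalize (G : sgraph) (k : nat) (Z : {set G}) (c : G -> nat) :
  hall k Z c -> (forall v, v \in Z -> c v = 0) ->
  exists Z' : {set G}, exists c' : G -> nat,
    [/\ hall k Z' c', forall v, v \in Z' -> c' v = 0,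
        forall v, 0 < c' v -> c' v < #|neighbors v :&: Z'|
      & #|Z| + \sum_v c' v <= #|Z'| + \sum_v c v].
Proof.
have [m le_m] := ubnP (\sum_v c v); elim: m => // m IH in Z c le_m *.
move=> hZ cZ.
have [/forallP ok|] := boolP [forall v, (0 < c v) ==> (c v < #|neighbors v :&: Z|)].
  by exists Z, c; split=> // v; apply/implyP.
rewrite negb_forall => /existsP[g]; rewrite negb_imply -leqNgt => /andP[cg0 cg].
pose c' v := if v == g then 0 else c v.
have sum_c : \sum_v c v = c g + \sum_v c' v.
  rewrite (bigD1 g) //= [in RHS](bigD1 g) //= {1}/c' eqxx add0n; congr (_ + _).
  by apply: eq_bigr => v /negPf vg; rewrite /c' vg.
have cardZ : #|Z| = #|Z :\: neighbors g| + #|neighbors g :&: Z|.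
  by rewrite setIC addnC cardsID.
have [||| Z' [c'' [h1 h2 h3 h4]]] := IH (Z :\: neighbors g) c'.
- by lia.
- move=> S /subsetDP[SZ Sg] Sk; apply: leq_trans (hZ S SZ Sk) _.
  apply: leq_sum => v /bigcupP[u uS]; rewrite inE => uv.
  rewrite /c'; case: eqP => // vg; move: uv; rewrite vg adj_sym => gu.
  by move/pred0P/(_ u): Sg; rewrite /= uS !inE gu.
- by move=> v /setDP[vZ _]; rewrite /c'; case: eqP => // _; exact: cZ.
by exists Z', c''; split=> //; lia.
Qed.

(** * Column coordinates *)

Definition row_of (r : bool) : 'I_2 := if r then ord_max else ord0.

Arguments row_of : simpl never.

Lemma row_ofP (i : 'I_2) : exists r, i = row_of r.
Proof.
by case: i => [[|[|//]] hi]; [exists false | exists true]; apply: val_inj.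
Qed.

Lemma row_of_eq (r s : bool) : (row_of r == row_of s) = (r == s).
Proof. by case: r; case: s. Qed.

Lemma grid_adjE (n : nat) (r s : bool) (i j : 'I_n) :
  adj (s := grid2 n) (row_of r, i) (row_of s, j) =
    ((r == s) && ((j == i.+1 :> nat) || (i == j.+1 :> nat)))
    || ((s == ~~ r) && (i == j)).
Proof.
rewrite /= /grid_adj /grid_arc /= !row_of_eq [j == i]eq_sym.
by case: r; case: s; rewrite /= ?orbF ?andbF.
Qed.

(* Columns are numbered from 1, with value [d] outside the grid. *)
Definition on_grid (n : nat) (T : Type) (d : T) (F : grid2 n -> T) (r : bool)
    (j : nat) : T :=
  if j is i.+1 then if insub i is Some i' then F (row_of r, i') else d else d.

Lemma on_gridE (n : nat) (T : Type) (d : T) (F : grid2 n -> T) r (i : 'I_n) :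
  on_grid d F r i.+1 = F (row_of r, i).
Proof. by rewrite /on_grid valK. Qed.

Lemma on_grid_out (n : nat) (T : Type) (d : T) (F : grid2 n -> T) r j :
  ~~ (0 < j <= n) -> on_grid d F r j = d.
Proof. by case: j => //= j jn; rewrite insubF //; apply/negbTE. Qed.

Variant on_grid_spec (n : nat) (j : nat) : Type :=
  | OnGridIn (i : 'I_n) of j = i.+1
  | OnGridOut of ~~ (0 < j <= n).

Lemma on_gridP (n j : nat) : on_grid_spec n j.
Proof.
case: (boolP (0 < j <= n)) => [|/OnGridOut //].
by case: j => // j jn; apply: (@OnGridIn n j.+1 (Ordinal jn)).
Qed.

Definition pre (a : nat -> nat) (j : nat) : nat := \sum_(i < j.+1) a i.

Lemma preS a j : pre a j.+1 = pre a j + a j.+1.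
Proof. by rewrite /pre big_ord_recr. Qed.

Lemma pre0 a : pre a 0 = a 0.
Proof. by rewrite /pre big_ord1. Qed.

Lemma sum_grid (n : nat) (F : grid2 n -> nat) :
  \sum_v F v = pre (on_grid 0 F false) n + pre (on_grid 0 F true) n.
Proof.
have -> : \sum_v F v = \sum_(i < 2) \sum_(j < n) F (i, j).
  by rewrite pair_bigA; apply: eq_bigr => -[].
rewrite /pre ![\sum_(_ < n.+1) _]big_ord_recl /= !add0n big_ord_recl big_ord1.
by congr (_ + _); apply: eq_bigr => i _; rewrite /= valK //=; congr (F (_, _)); apply: val_inj.
Qed.

Record config (k n : nat) (z : bool -> nat -> bool) (c : bool -> nat -> nat) : Prop :=
  Config {
    zero_cap : forall r j, z r j -> c r j = 0;
    zero_range : forall r j, z r j -> 0 < j <= n;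
    cap_range : forall r j, 0 < c r j -> 0 < j <= n;
    cap_lt : forall r j, 0 < c r j -> c r j < z r j.-1 + z r j.+1 + z (~~ r) j;
    hall_pre : forall S : bool -> nat -> bool, (forall r j, S r j -> z r j) ->
      pre (S false) n + pre (S true) n <= k ->
      pre (S false) n + pre (S true) n <=
      pre (fun j => c false j * [|| S false j.-1, S false j.+1 | S true j]) n +
      pre (fun j => c true j * [|| S true j.-1, S true j.+1 | S false j]) n
  }.

Lemma card_on_grid (n : nat) (Z : {set grid2 n}) r j :
  #|[set u in Z | (u.1 == row_of r) && (u.2.+1 == j)]| =
  on_grid false (fun v => v \in Z) r j.
Proof.
case: (on_gridP n j) => [i ->|jn].
  rewrite on_gridE; case: (boolP (_ \in Z)) => uZ.
    rewrite (_ : [set _ in _ | _] = [set ((row_of r, i) : grid2 n)]) ?cards1 //.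
    apply/setP => -[a b]; rewrite !inE /= eqSS xpair_eqE.
    by case: (eqVneq a (row_of r)) => [->|]; rewrite ?andbF //=; case: (eqVneq b i) => [->|];
      rewrite ?andbF ?andbT ?uZ ?eqxx // => /negPf; rewrite -val_eqE /= => ->; rewrite andbF.
  apply/eqP; rewrite cards_eq0; apply/eqP/setP => -[a b]; rewrite !inE /= eqSS.
  by apply/negP => /and3P[abZ /eqP ea /eqP/val_inj eb]; rewrite ea eb (negPf uZ) in abZ.
rewrite on_grid_out //; apply/eqP; rewrite cards_eq0; apply/eqP/setP => -[a b].
rewrite !inE /=; apply/negP => /and3P[_ _ /eqP bj].
by move: jn; rewrite -bj ltn_ord.
Qed.

Lemma config_of_hall (k n : nat) (Z : {set grid2 n}) (c : grid2 n -> nat) :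
  hall k Z c -> (forall v, v \in Z -> c v = 0) ->
  (forall v, 0 < c v -> c v < #|neighbors v :&: Z|) ->
  config k n (on_grid false (fun v => v \in Z)) (on_grid 0 c).
Proof.
set z := on_grid false _ => hZ cZ cN; split=> [r j|r j|r j|r j|S Sz].
- rewrite /z; case: (on_gridP n j) => [i ->|jn]; last by rewrite !on_grid_out.
  by rewrite !on_gridE; apply: cZ.
- by rewrite /z; apply: contraTT => jn; rewrite on_grid_out.
- by apply: contraTT => jn; rewrite on_grid_out.
- case: (on_gridP n j) => [i ->|jn]; last by rewrite !on_grid_out.
  rewrite on_gridE => /cN/leq_trans; apply.
  rewrite /z -!card_on_grid; set X := [set _ in _ | _]; set Y := [set _ in _ | _].
  set W := [set _ in _ | _].
  suff /subset_leq_card/leq_trans : neighbors ((row_of r, i) : grid2 n) :&: Z \subset X :|: Y :|: W.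
    by apply; apply: leq_trans (leq_card_setU _ _) _; rewrite leq_add2r leq_card_setU.
  apply/subsetP => -[a b]; have [s ->] := row_ofP a; rewrite in_setI [_ \in neighbors _]inE grid_adjE.
  rewrite !inE /= !row_of_eq => /andP[/orP[/andP[/eqP rs /orP[]/eqP e]|/andP[/eqP -> /eqP ->]] -> /=].
  + by rewrite rs e !eqxx orbT.
  + by rewrite rs e !eqxx.
  + by rewrite !eqxx !orbT.
- have Sg r j : S r j = on_grid false (fun v : grid2 n => S (v.1 == row_of true) v.2.+1) r j.
    case: (on_gridP n j) => [i ->|jn]; first by rewrite on_gridE; case: r.
    rewrite on_grid_out //; apply/negP => /Sz; rewrite /z on_grid_out //.
  pose S' := [set v : grid2 n | S (v.1 == row_of true) v.2.+1].
  have S'r r (i : 'I_n) : (((row_of r, i) : grid2 n) \in S') = S r i.+1.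
    by rewrite inE; case: r.
  have cS : #|S'| = pre (S false) n + pre (S true) n.
    rewrite -sum1_card big_mkcond sum_grid; congr (_ + _); apply: eq_bigr => i _;
      by (case: (on_gridP n i) => [j ->|jn];
      [rewrite on_gridE S'r; case: (S _ _)|rewrite Sg !on_grid_out]).
  move=> Sk; have Sk' : #|S'| <= k by rewrite cS.
  rewrite -[X in X <= _]cS; apply: leq_trans (hZ S' _ Sk') _.
    apply/subsetP => -[a b]; have [s ->] := row_ofP a; rewrite S'r => /Sz.
    by rewrite /z on_gridE.
  rewrite big_mkcond sum_grid.
  have key r j : on_grid 0 (fun v => if v \in nbhd S' then c v else 0) r j <=
     on_grid 0 c r j * [|| S r j.-1, S r j.+1 | S (~~ r) j].
    case: (on_gridP n j) => [i ->|jn]; last by rewrite on_grid_out.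
    rewrite !on_gridE; case: ifP => // /bigcupP[[a b]]; have [s ->] := row_ofP a.
    rewrite S'r [_ \in neighbors _]inE grid_adjE => Ss.
    case/orP=> [/andP[/eqP rs /orP[]/eqP e]|/andP[/eqP e1 /eqP e2]].
    + by rewrite e /= -rs Ss muln1.
    + by rewrite -e /= -rs Ss orbT muln1.
    + by rewrite e1 negbK -e2 Ss !orbT muln1.
  by apply: leq_add; apply: leq_sum => i _; apply: key.
Qed.

Lemma pre_window (a : nat -> nat) (lo hi n : nat) :
  lo <= hi -> (forall j, n < j -> a j = 0) ->
  pre (fun j => if lo < j <= hi then a j else 0) n = pre a hi - pre a lo.
Proof.
move=> lohi a0.
have stable m : pre a (minn m n) = pre a m.
  elim: m => [|m IH]; first by rewrite min0n.
  case: (boolP (m < n)) => [mn|nm]; first by congr (pre a); lia.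
  have am : a m.+1 = 0 by apply: a0; lia.
  by rewrite preS am addn0 -IH; congr (pre a); lia.
rewrite -[pre a hi]stable -[pre a lo]stable {a0 stable}.
elim: n => [|n IH]; first by rewrite !minn0 !pre0 subnn /=.
rewrite preS IH; case: (boolP (hi <= n)) => [hn|nh].
  have [-> -> -> ->] : [/\ minn hi n = hi, minn hi n.+1 = hi, minn lo n = lo & minn lo n.+1 = lo].
    by split; lia.
  by case: ifP; lia.
have [-> ->] : minn hi n = n /\ minn hi n.+1 = n.+1 by split; lia.
case: (boolP (lo <= n)) => [ln|nl].
  have [-> ->] : minn lo n = lo /\ minn lo n.+1 = lo by split; lia.
  have le_pre : pre a lo <= pre a n.
    rewrite -(subnK ln); elim: (n - lo) => // d; rewrite addSn preS; lia.
  by rewrite preS; case: ifP; lia.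
have [-> ->] : minn lo n = n /\ minn lo n.+1 = n.+1 by split; lia.
by case: ifP; lia.
Qed.

Lemma pre_le a b n : (forall j, a j <= b j) -> pre a n <= pre b n.
Proof. by move=> ab; apply: leq_sum. Qed.

Lemma preD a b n : pre (fun j => a j + b j) n = pre a n + pre b n.
Proof. exact: big_split. Qed.

Lemma pre_eq1 m x n : pre (fun j => if j == m then x else 0) n <= x.
Proof.
rewrite /pre; case: (leqP n.+1 m) => [nm|mn].
  by rewrite big1 // => i _; case: eqP => // im; have := ltn_ord i; lia.
rewrite (bigD1 (Ordinal mn)) //= eqxx big1 ?addn0 // => i.
by rewrite -val_eqE /= => /negPf->.
Qed.

(** * Excess of a proper labeling *)

Section Sweep.

Variables (k n : nat) (z : bool -> nat -> bool) (c : bool -> nat -> nat).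
Hypothesis cfg : config k n z c.

Definition zeros_upto r j := pre (fun i => z r i) j.
Definition caps_upto r j := pre (c r) j.

(** Hall's condition for the zeros in columns [(lo r).+1] to [hi r] of each row [r]. Outside the
    windows only the guards at [lo r] and [(hi r).+1] can help, as [vert] rules out vertical
    neighbours. The windows of the rows may differ, so that a front can split a column. *)
Lemma hall_window (lo hi : bool -> nat) :
  (forall r, lo r <= hi r) ->
  (forall r j, z (~~ r) j -> lo (~~ r) < j <= hi (~~ r) ->
     c r j = 0 \/ lo r < j <= hi r) ->
  let m := fun r => zeros_upto r (hi r) - zeros_upto r (lo r) in
  let w := fun r => caps_upto r (hi r) - caps_upto r (lo r)
    + (if z r (lo r).+1 then c r (lo r) else 0)
    + (if z r (hi r) then c r (hi r).+1 else 0) in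
  m false + m true <= k -> m false + m true <= w false + w true.
Proof.
move=> lohi vert m w.
pose S r j := z r j && (lo r < j <= hi r).
have z_out r j : n < j -> (z r j : nat) = 0.
  by move=> nj; case: (boolP (z r j)) => // /(zero_range cfg); lia.
have c_out r j : n < j -> c r j = 0.
  by move=> nj; have [//|/(cap_range cfg)] := posnP (c r j); lia.
have mS r : pre (S r) n = m r.
  rewrite /m /zeros_upto -(pre_window (n := n)) //; last exact: z_out.
  by apply: eq_bigr => j _; rewrite /S; case: (z r j); case: ifP.
rewrite -!mS => /(hall_pre cfg) H; apply: leq_trans (H _) _.
  by move=> r j /andP[].
have wS r : pre (fun j => c r j * [|| S r j.-1, S r j.+1 | S (~~ r) j]) n <= w r.
  rewrite /w /caps_upto -(@pre_window (c r) (lo r) (hi r) n) //; last exact: c_out.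
  pose X := if z r (lo r).+1 then c r (lo r) else 0.
  pose Y := if z r (hi r) then c r (hi r).+1 else 0.
  apply: leq_trans (leq_add (leq_add (leqnn _) (pre_eq1 (lo r) X n)) (pre_eq1 (hi r).+1 Y n)).
  rewrite -!preD; apply: pre_le => j.
  have [->|c0] := posnP (c r j); first by rewrite mul0n.
  have j0 : 0 < j by case/andP: (cap_range cfg c0).
  case: (boolP (lo r < j <= hi r)) => [_|jout]; first by case: [|| _, _ | _]; lia.
  case/boolP: (S r j.-1) => /= [/andP[zj lj]|_].
    have -> : j = (hi r).+1 by lia.
    have zh : z r (hi r) by rewrite (_ : hi r = j.-1) //; lia.
    by rewrite /Y zh !eqxx; lia.
  case/boolP: (S r j.+1) => /= [/andP[zj lj]|_].
    have -> : j = lo r by lia.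
    have zh : z r (lo r).+1 by rewrite (_ : lo r = j) //; lia.
    by rewrite /X zh !eqxx; lia.
  case/boolP: (S (~~ r) j) => /= [/andP[zj lj]|_]; last by rewrite muln0.
  by have [|] := vert r j zj lj; lia.
by apply: leq_add; apply: wS.
Qed.

Local Open Scope ring_scope.

Definition excess (j : nat) : int :=
  (zeros_upto false j + zeros_upto true j)%N%:Z
  - (caps_upto false j + caps_upto true j)%N%:Z.

Definition both_zero j := z false j && z true j.

Definition two_guards j := (0 < c false j)%N && (0 < c true j)%N.

(* A front [(o, j)] stands for the set of zeros of the columns up to [j],
   together with [(r, j + 1)] if [o = Some r]. *)
Definition front_ok (o : option bool) (j : nat) : bool :=
  if o is Some r then both_zero j.+1 else true.

Definition front_card (o : option bool) (j : nat) : nat :=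
  (zeros_upto false j + zeros_upto true j + isSome o)%N.

(* With [A] the set of zeros of a front, [lower] is [#|A|] minus the strength
   of all neighbours of [A], and [upper] counts only those neighbours that have
   no zero neighbour outside [A]. *)
Definition lower (o : option bool) (j : nat) : int :=
  if o is Some r then excess j + 1 - (c r j.+2)%:Z
  else excess j - (if z false j then c false j.+1 else 0%N)%:Z
                - (if z true j then c true j.+1 else 0%N)%:Z.

Definition upper (o : option bool) (j : nat) : int :=
  if o is Some r then excess j + 1 + (c (~~ r) j)%:Z
  else excess j + (if z false j.+1 then c false j else 0%N)%:Z
                + (if z true j.+1 then c true j else 0%N)%:Z.

Lemma excess0 : excess 0 = 0.
Proof.
rewrite /excess /zeros_upto /caps_upto !pre0.
have z0 r : z r 0 = false by apply/negP => /(zero_range cfg).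
have c0 r : c r 0 = 0%N by have [//|/(cap_range cfg)] := posnP (c r 0).
by rewrite !z0 !c0.
Qed.

Lemma excessS j :
  excess j.+1 = excess j + (z false j.+1 + z true j.+1)%N%:Z
                         - (c false j.+1 + c true j.+1)%N%:Z.
Proof. rewrite /excess /zeros_upto /caps_upto !preS; lia. Qed.

Lemma pre_homo (a : nat -> nat) : {homo pre a : i j / (i <= j)%N}.
Proof.
by move=> i j ij; rewrite -(subnK ij); elim: (j - i)%N => // d IH; rewrite addSn preS; lia.
Qed.

(** Hall's condition for the zeros between the fronts: the guards next to them are neighbours of the
    second front and have a zero ahead of the first, so their strength is subtracted in [lower o' b]
    but not in [upper o a]. *)
Lemma lower_le_upper o a o' b :
  front_ok o a -> front_ok o' b -> (a + isSome o <= b)%N ->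
  (front_card o' b <= front_card o a + k)%N -> lower o' b <= upper o a.
Proof.
move=> oka okb ab cnt.
pose lo r := (a + (o == Some r))%N; pose hi r := (b + (o' == Some r))%N.
have zz r j : both_zero j -> z r j by case/andP; case: r.
have cz r j : both_zero j -> c r j = 0%N by move/(zz r)/(zero_cap cfg).
have lohi r : (lo r <= hi r)%N by rewrite /lo /hi; case: (o) ab => [s|] /=; lia.
(* The windows differ only in columns [a.+1] and [b.+1], and only if these consist of two zeros and
   so have no guard. *)
have vert r j : z (~~ r) j -> (lo (~~ r) < j <= hi (~~ r))%N ->
    c r j = 0%N \/ (lo r < j <= hi r)%N.
  rewrite /lo /hi => zj jr.
  have [ja|ja] := eqVneq j a.+1.
    case: (o) oka jr ab => [s|] /=; first by rewrite -ja => /cz->; left.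
    case: (o') okb => [s|] /=; last by right; lia.
    by have [<-|jb] := eqVneq j b.+1; [move/cz; left | right; lia].
  have [jb|jb] := eqVneq j b.+1; last by right; lia.
  case: (o') okb jr => [s|] /=; first by rewrite -jb => /cz->; left.
  by lia.
have cza r s : o = Some s -> c r a.+1 = 0%N by move=> os; rewrite os in oka; apply: cz.
have czb r s : o' = Some s -> c r b.+1 = 0%N by move=> os; rewrite os in okb; apply: cz.
have win := hall_window lohi vert; rewrite /= /lo /hi in win.
have Z0 r := @pre_homo (fun i => z r i) a b.
have C0 r := @pre_homo (c r) a b.
have Z1 r := @pre_homo (fun i => z r i) a.+1 b.
have C1 r := @pre_homo (c r) a.+1 b.
move: cnt win; rewrite /front_card /lower /upper /excess /zeros_upto /caps_upto.
case: (o) oka cza ab => [s|] /= oka cza ab; case: (o') okb czb => [s'|] /= okb czb.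
- case/andP: oka => za zb; case/andP: okb => za' zb'.
  have c1 r := cza r s erefl; have c2 r := czb r s' erefl.
  move: (Z1 true) (Z1 false) (C1 true) (C1 false).
  by case: s {cza lohi vert lo hi}; case: s' {czb};
    rewrite !eqE /= ?addn1 ?addn0 !preS ?za ?zb ?za' ?zb' ?c1 ?c2 ?if_same /=; lia.
- case/andP: oka => za zb; have c1 r := cza r s erefl.
  move: (Z0 true) (Z0 false) (C0 true) (C0 false).
  move: (Z1 true) (Z1 false) (C1 true) (C1 false).
  by case: s {cza lohi vert lo hi};
    rewrite !eqE /= ?addn1 ?addn0 !preS ?za ?zb ?c1 ?if_same /=; lia.
- case/andP: okb => za' zb'; have c2 r := czb r s' erefl.
  move: (Z0 true) (Z0 false) (C0 true) (C0 false).
  by case: s' {czb lohi vert lo hi};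
    rewrite !eqE /= ?addn1 ?addn0 !preS ?za' ?zb' ?c2 ?if_same /=; lia.
move: (Z0 true) (Z0 false) (C0 true) (C0 false).
by rewrite /= !addn0; lia.
Qed.


End Sweep.

(** * The sweep and the upper bounds on the excess *)

Section Bounds.

Variables (k n : nat) (z : bool -> nat -> bool) (c : bool -> nat -> nat).
Hypothesis cfg : config k n z c.

Local Notation excess := (excess z c).
Local Notation both_zero := (both_zero z).
Local Notation two_guards := (two_guards c).
Local Notation front_ok := (front_ok z).
Local Notation front_card := (front_card z).
Local Notation lower := (lower z c).
Local Notation upper := (upper z c).

Local Open Scope ring_scope.

Lemma both_zero_caps j r : both_zero j -> c r j = 0%N.
Proof. by case/andP=> zf zt; apply: (zero_cap cfg); case: r. Qed.

(** The vertical neighbour of each guard is not a zero, so [cap_lt] leaves only strength 1 with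
    zeros on both sides. *)
Lemma two_guards_around j : two_guards j.+1 ->
  [/\ both_zero j, both_zero j.+2 & forall r, c r j.+1 = 1%N].
Proof.
case/andP=> cf ct.
have cp r : (0 < c r j.+1)%N by case: r.
have zn r : z r j.+1 = false.
  by apply/negP => /(zero_cap cfg) c0; have := cp r; rewrite c0.
have H r : [/\ z r j, z r j.+2 & c r j.+1 = 1%N].
  by have := cap_lt cfg (cp r); have := cp r; rewrite zn /=;
    case: (z r j); case: (z r j.+2) => /=; split=> //; lia.
have [[f1 f2 _] [t1 t2 _]] := (H false, H true).
by split=> [||r]; [apply/andP | apply/andP | have [] := H r].
Qed.

Lemma two_guards_zero j r : two_guards j -> z r j = false.
Proof.
case/andP=> cf ct; apply/negP => /(zero_cap cfg) c0.
by case: r c0 cf ct => ->.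
Qed.

Lemma front_cardS j :
  front_card None j.+1 = (front_card None j + (z false j.+1 + z true j.+1))%N.
Proof. by rewrite /front_card /zeros_upto !preS; lia. Qed.

(** At most [j - s] zeros lie between the front and the end of column [j], which leaves [s + k - j]
    of the [k] zeros that Hall's condition admits. *)
Definition reachable (M : int) (s j : nat) : Prop :=
  exists o a, [/\ front_ok o a, (a + isSome o <= j)%N, upper o a <= M
    & (front_card None j <= front_card o a + (j - s))%N].

(* When [lower] is already [M] before a column of two zeros, both zeros must be
   defended by the next column, whose two guards cancel them. *)
Definition sweep_state (M : int) (s j : nat) : Prop :=
  reachable M s j \/
  [/\ (s < j)%N, reachable M s j.-1, both_zero j, two_guards j.+1
    & excess j.-1 = M].

Lemma reachable_lower M s j o b : reachable M s j -> front_ok o b ->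
  (j <= b)%N -> (s <= j)%N -> (front_card o b <= front_card None j + (s + k - j))%N ->
  (j <= s + k)%N -> lower o b <= M.
Proof.
case=> o' [a [ok aj up cnt]] okb jb sj cntb jk.
by apply: le_trans up; apply: (lower_le_upper cfg) => //; lia.
Qed.

Lemma sweep_step M s j :
  ~~ two_guards s -> (s <= j < s + k)%N ->
  ((s < j)%N -> sweep_state M s j.-1) -> sweep_state M s j -> sweep_state M s j.+1.
Proof.
move=> sg sjk IHp [[o [a [ok aj up cnt]]]|[sj [o [a [ok aj up cnt]]] zj gj ej]]; last first.
  (* Columns [j] and [j.+1] together hold two zeros, so the old front still serves. *)
  left; exists o, a; split=> //; first by lia.
  rewrite front_cardS !(two_guards_zero _ gj).
  case: j sj cnt aj {IHp zj gj ej sjk} => // j sj cnt aj; rewrite front_cardS.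
  by case: (z false j.+1); case: (z true j.+1) => /=; move: cnt => /=; lia.
have rj : reachable M s j by exists o, a.
case: (boolP (both_zero j.+1)) => [zz|nz]; last first.
  left; exists o, a; split=> //; first by lia.
  move: nz; rewrite /both_zero front_cardS.
  by case: (z false j.+1); case: (z true j.+1) => //=; lia.
have cj r : c r j.+1 = 0%N by exact: both_zero_caps.
have [zf zt] := andP zz.
have Pj : lower None j = excess j by rewrite /lower !cj !if_same; lia.
have Pj_le : excess j <= M.
  by rewrite -Pj; apply: (@reachable_lower M s j) => //; lia.
have mid r : lower (Some r) j <= M.
  by apply: (@reachable_lower M s j) => //; rewrite /front_card /=; lia.
case: (ltP (excess j) M) => [lt|ge]; last first.
  (* Here [excess j] is [M], and [mid] forces a guard in both rows of column [j.+2]. *)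
  right; split=> //; first by lia.
  - by have := mid false; have := mid true; rewrite /lower /two_guards; lia.
  - by apply: le_anti; rewrite Pj_le.
case: (boolP (two_guards j)) => [gj|ngj]; last first.
  (* Restart between the two zeros: the first one taken is in the row opposite to one without a
     guard in column [j]. *)
  left.
  have [r cr0] : exists r, c (~~ r) j = 0%N.
    move: ngj; rewrite /two_guards negb_and -!leqNgt !leqn0.
    by case/orP=> /eqP e; [exists true | exists false].
  exists (Some r), j; split=> //=; first by lia.
  - by rewrite cr0; lia.
  - by rewrite front_cardS /front_card zf zt /=; lia.
(* Column [j] has no zeros and balances column [j.+1], so a front that serves at [j.-1] is kept. The
   other state at [j.-1] would give [excess j = M], against [lt]. *)
have sj : (s < j)%N by rewrite ltn_neqAle; apply/andP; split; [apply: contraNneq sg => -> | lia].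
case: j sj gj sjk IHp aj cnt rj zz cj zf zt Pj Pj_le mid lt => // j sj gj sjk IHp aj cnt rj zz cj zf zt Pj Pj_le mid lt.
case: (IHp sj) => /= [|[sj' _ zj' _ ej]].
  case=> o' [a' [ok' aj' up' cnt']]; left; exists o', a'; split=> //; first by lia.
  by rewrite !front_cardS !(two_guards_zero _ gj) zf zt /=; lia.
have [_ _ c1] := two_guards_around gj.
case: j sj' zj' ej {IHp aj cnt rj sj sjk Pj Pj_le mid} gj c1 lt zz cj zf zt => // j sj' zj' ej gj c1 lt zz cj zf zt.
move: lt; rewrite !excessS !c1 !(two_guards_zero _ gj) !(both_zero_caps _ zj') /=.
by case/andP: zj' => -> ->; rewrite /= in ej *; lia.
Qed.

Lemma sweep M s j : upper None s <= M -> ~~ two_guards s -> (s <= j <= s + k)%N ->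
  sweep_state M s j.
Proof.
move=> up sg.
have H d : (d <= k)%N -> sweep_state M s (s + d) /\ ((0 < d)%N -> sweep_state M s (s + d).-1).
  elim: d => [|d IH] dk.
    by rewrite addn0; split=> //; left; exists None, s; split=> //=; lia.
  have [S1 S2] := IH (ltnW dk); rewrite addnS; split=> // .
  by apply: sweep_step => //; [lia | move=> sd; apply: S2; lia].
move=> sj; have [|+ _] := H (j - s)%N; first by lia.
by rewrite subnKC //; lia.
Qed.

Definition below (M : int) (m : nat) : Prop :=
  forall o j, front_ok o j -> (j + isSome o <= m)%N -> lower o j <= M.

Lemma sweep_lower M s o j : upper None s <= M -> ~~ two_guards s ->
  front_ok o j -> (s <= j)%N -> (j + isSome o <= s + k)%N -> lower o j <= M.
Proof.
move=> up sg ok sj jk.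
have [] := @sweep M s j up sg; first by lia.
  move=> rj; apply: (reachable_lower rj) => //; last by lia.
  by rewrite /front_card; lia.
case: o ok jk => [r|] /= ok jk [sj' _ zj gj ej].
  by have := two_guards_zero false gj; case/andP: ok => ->.
case: j zj gj ej {sj jk ok} sj' => // j zj gj ej sj'.
have [_ _ c1] := two_guards_around gj.
rewrite excessS !c1 !(both_zero_caps _ zj).
by case/andP: zj => -> ->; rewrite /= in ej *; lia.
Qed.

Lemma below0 : below 0 k.
Proof.
have c0 r : c r 0 = 0%N by have [//|/(cap_range cfg)] := posnP (c r 0).
move=> o j ok jk; apply: (@sweep_lower 0 0) => //.
- by rewrite /upper (excess0 cfg) !c0 !if_same.
- by rewrite /two_guards c0.
Qed.

Lemma excess_le M m r : below M m -> z r m -> z (~~ r) m.+1 -> excess m <= M + 1.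
Proof.
case: m => [|m] bM zr zs; first by have := zero_range cfg zr.
have cr : c r m.+1 = 0%N by exact: (zero_cap cfg).
have cs : c (~~ r) m.+2 = 0%N by exact: (zero_cap cfg).
case: (boolP (both_zero m.+1)) => [zz|nz].
  have := bM (Some (~~ r)) m zz; rewrite /= addn1 leqnn cs => /(_ isT).
  by rewrite excessS; case: (z false _); case: (z true _) => /=; lia.
have := bM None m isT; rewrite /= addn0 leqnSn => /(_ isT).
move: nz; rewrite /both_zero excessS.
case: r zr cr {zs cs} => -> ->; rewrite ?andbT /= => /negPf ->; case: (z false m); case: (z true m) => /=; lia.
Qed.

(** The gain over [lower None m] is the number of zeros in column [m.+1] plus the strength of its
    guards with zeros on both sides. It exceeds 2 only for a guard of strength 2 that shares its
    column with a zero, and there [excess_le] applies. *)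
Lemma upper_of_below M m : below M m -> upper None m.+1 <= M + 2.
Proof.
move=> bM.
have Pm : lower None m <= M by apply: bM; rewrite //= addn0.
have cz r : z r m.+1 -> c r m.+1 = 0%N by exact: (zero_cap cfg).
have cl r : c r m.+1 = 0%N \/ (c r m.+1 < z r m + z r m.+2 + z (~~ r) m.+1)%N.
  by have [|/(cap_lt cfg)] := posnP (c r m.+1); [left | right].
have ef := @excess_le M m false bM; have et := @excess_le M m true bM.
move: Pm ef et (cl false) (cl true) (cz false) (cz true); rewrite /upper excessS /=.
case: (z false m); case: (z true m); case: (z false m.+1); case: (z true m.+1);
  case: (z false m.+2); case: (z true m.+2) => /=; lia.
Qed.

Lemma below_succ M m : below M m -> below (M + 2) m.+1.
Proof.
move=> bM o j ok; rewrite leq_eqVlt => /orP[/eqP jm|jm]; last first.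
  by apply: le_trans (bM o j ok jm) _; lia.
case: o ok jm => [r|] /= ok jm; last first.
  by rewrite (_ : j = m.+1); [have := upper_of_below bM; rewrite /upper | ]; lia.
have jE : j = m by lia.
rewrite jE in ok *.
have := bM None m isT; rewrite /= addn0 leqnn !(both_zero_caps _ ok) !if_same => /(_ isT).
lia.
Qed.

Lemma below_two_guards M m : below M m -> two_guards m.+1 -> below M m.+1.
Proof.
move=> bM gm o j ok; rewrite leq_eqVlt => /orP[/eqP jm|]; last exact: bM.
case: o ok jm => [r|] /= ok jm.
  by move: ok; rewrite (_ : j = m); [rewrite /both_zero (two_guards_zero _ gm)|lia].
have -> : j = m.+1 by lia.
have [_ _ c1] := two_guards_around gm.
have := bM None m isT; rewrite /= addn0 leqnn => /(_ isT).
rewrite excessS !(two_guards_zero _ gm) !c1.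
by case: (z false m); case: (z true m) => /=; lia.
Qed.

(** One column costs 2 by [upper_of_below]; the sweep then covers [k] more at no further cost. It
    must not start at a column of two guards, but such a column is free and no two of them are
    adjacent. *)
Lemma below_step M m : below M m -> below (M + 2) (m + k.+1).
Proof.
move=> bM.
have [s [ms bs sg]] : exists s, [/\ (m <= s)%N, below M s & ~~ two_guards s.+1].
  case: (boolP (two_guards m.+1)) => gm; last by exists m.
  exists m.+1; split=> //; first exact: below_two_guards.
  apply/negP => gm'; have [_ /andP[zf _] _] := two_guards_around gm.
  by rewrite (two_guards_zero _ gm') in zf.
move=> o j ok jm; case: (leqP s.+1 j) => [sj|js].
  by apply: (@sweep_lower _ s.+1) => //; [exact: upper_of_below | lia].
by apply: (below_succ bs) => //; case: (o) => [r|] /=; lia.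
Qed.

Lemma below_iter i : below (i.*2)%:Z (i * k.+1 + k).
Proof.
elim: i => [|i IH]; first exact: below0.
rewrite (_ : _%:Z = (i.*2)%:Z + 2); last by lia.
by rewrite mulSnr addnAC; apply: below_step.
Qed.

Lemma lower_last : lower None n = excess n.
Proof.
have c0 r : c r n.+1 = 0%N by have [//|/(cap_range cfg)] := posnP (c r n.+1); lia.
by rewrite /= !c0 !if_same; lia.
Qed.

Lemma excess_bound : excess n <= ((n %/ k.+1).*2)%:Z.
Proof.
rewrite -lower_last; apply: below_iter => //=.
by rewrite addn0 {1}(divn_eq n k.+1) leq_add2l -ltnS ltn_pmod.
Qed.

(** After column [j], [t] columns of two guards separate [t.+1] columns of two zeros, up to the
    right end of the grid. *)
Definition alternating_end (q j t : nat) : Prop :=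
  [/\ n = (j + t.*2).+1, both_zero j.+1, excess j = (q.*2)%:Z,
      forall i, (j < i <= n)%N -> both_zero i || two_guards i
    & forall r, zeros_upto z r n = (zeros_upto z r j + t.+1)%N /\
                caps_upto c r n = (caps_upto c r j + t)%N].

Lemma alternating_end_next q j t : (t < k)%N -> alternating_end q j t ->
  exists j', alternating_end q j' t.+1.
Proof.
move=> tk [nE zj ej alt cnt].
have cN r : c r n.+1 = 0%N by have [//|/(cap_range cfg)] := posnP (c r n.+1); lia.
have zN r : z r n.+1 = false by apply/negP => /(zero_range cfg); lia.
have cpos r : (0 < c r j)%N.
  (* Hall's condition for the last [t.+1] zeros of row [r] alone: the guards of the row after column
     [j] have total strength [t], so the one at [j] must help. *)
  pose lo s := if s == r then j else n.
  have lohi s : (lo s <= n)%N by rewrite /lo; case: ifP => _ //; lia.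
  have vert s i : z (~~ s) i -> (lo (~~ s) < i <= n)%N ->
      c s i = 0%N \/ (lo s < i <= n)%N.
    move=> zi; rewrite /lo => hi; left; apply: both_zero_caps.
    have /orP[//|gi] : both_zero i || two_guards i.
      by apply: alt; move: hi; case: ifP; lia.
    by rewrite (two_guards_zero _ gi) in zi.
  have := hall_window cfg lohi vert; rewrite /= /lo.
  have [zf zt] := andP zj; have [Zf Cf] := cnt false; have [Zt Ct] := cnt true.
  by case: r {lo lohi vert} => /=; rewrite ?zf ?zt !cN !if_same ?Zf ?Cf ?Zt ?Ct !subnn !zN; lia.
have gj : two_guards j by rewrite /two_guards !cpos.
case: j nE zj ej alt cnt cpos gj => [|[|j]] nE zj ej alt cnt cpos gj.
- by have := cap_range cfg (cpos false).
- have [/andP[z0 _] _ _] := two_guards_around gj.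
  by have := zero_range cfg z0.
have [zz _ c1] := two_guards_around gj; have [zf zt] := andP zz.
exists j; split=> //.
- by rewrite nE doubleS; lia.
- by move: ej; rewrite !excessS !c1 !(two_guards_zero _ gj) !(both_zero_caps _ zz) zf zt /=; lia.
- move=> i ji; have [->|i1] := eqVneq i j.+1; first by rewrite zz.
  have [->|i2] := eqVneq i j.+2; first by rewrite gj orbT.
  by apply: alt; lia.
move=> r; have [-> ->] := cnt r; rewrite /zeros_upto /caps_upto !preS c1.
rewrite (two_guards_zero _ gj) (both_zero_caps _ zz).
by have -> : z r j.+1 by [case: (r)]; lia.
Qed.

(* The last column would have to consist of two zeros, both defended from the left
   only; each row of the resulting alternating pattern has one zero more than
   guards, so the pattern extends too far to the left. *)
Lemma excess_bound_dvd q : (0 < k)%N -> n = (q.+1 * k.+1)%N ->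
  excess n <= (q.*2.+1)%:Z.
Proof.
move=> k0 nE; rewrite leNgt; apply/negP => big.
have Hn : n = (q * k.+1 + k).+1 by rewrite nE mulSn; lia.
have cN r : c r n.+1 = 0%N by have [//|/(cap_range cfg)] := posnP (c r n.+1); lia.
have start : alternating_end q (q * k.+1 + k) 0.
  set j := (q * k.+1 + k)%N in Hn *.
  have Pj : lower None j <= (q.*2)%:Z by apply: below_iter; rewrite //= addn0.
  have cz r : z r j.+1 -> c r j.+1 = 0%N by exact: (zero_cap cfg).
  (* The last column can add at most 2 to [lower None j], hence equality holds throughout. *)
  have [zz ej] : both_zero j.+1 /\ excess j = (q.*2)%:Z.
    move: big Pj (cz false) (cz true); rewrite Hn excessS /= /both_zero.
    by case: (z false j); case: (z true j); case: (z false j.+1); case: (z true j.+1) => /=;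
      (split => //; lia) || lia.
  split=> //; first by rewrite addn0.
    by move=> i ij; rewrite (_ : i = j.+1) ?zz //; lia.
  move=> r; rewrite Hn /zeros_upto /caps_upto !preS (both_zero_caps _ zz).
  by have -> : z r j.+1 by [case/andP: zz; case: (r)]; lia.
have [j [jE zj ej _ _]] : exists j, alternating_end q j k.
  have H t : (t <= k)%N -> exists j, alternating_end q j t.
    elim: t => [|t IH] tk; first by exists (q * k.+1 + k)%N.
    by have [j /(alternating_end_next tk)] := IH (ltnW tk).
  exact: H.
(* For q = 0 the pattern is wider than the grid. Otherwise j = (q - 1)(k + 1) + 1, where the excess
   is at most 2(q - 1). *)
case: q {big start} nE Hn ej => [|q] nE Hn ej; first by lia.
have := @below_iter q None j isT; rewrite /= !(both_zero_caps _ zj) !if_same ej.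
have -> : (j + 0 <= q * k.+1 + k)%N by lia.
by move=> /(_ isT); lia.
Qed.

End Bounds.

(** * Lower bound on the weight *)

Lemma excess_grid (n : nat) (Z : {set grid2 n}) (c : grid2 n -> nat) :
  (excess (on_grid false (fun v => v \in Z)) (on_grid 0 c) n =
   #|Z|%:Z - (\sum_v c v)%N%:Z)%R.
Proof.
rewrite /excess /zeros_upto /caps_upto sum_grid; congr (_%:Z - _)%R.
rewrite -sum1_card big_mkcond sum_grid; congr (_ + _); apply: eq_bigr => i _;
  by case: (on_gridP n i) => [j ->|jn]; rewrite ?on_gridE ?on_grid_out //; case: (_ \in Z).
Qed.

Lemma weight_ge (k n : nat) (f : labeling (grid2 n) k) :
  0 < k -> 0 < n -> k <= n.*2 -> proper_kSRD f ->
  n.*2 + (k.+1 %| n) <= weight f + (n %/ k.+1).*2.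
Proof.
move=> k0 n0 kn fP.
have cardG : #|grid2 n| = n.*2 by rewrite card_prod !card_ord mul2n.
have hf : hall k [set v | f v == 0 :> nat] (fun v => f v - 1).
  by apply: hall_of_proper fP; rewrite cardG.
have [|Z [c [hZ cZ cN le]]] := hall_normalize hf.
  by move=> v; rewrite inE => /eqP->.
have cfg := config_of_hall hZ cZ cN.
have wE : weight f + #|[set v | f v == 0 :> nat]| = \sum_v (f v - 1) + n.*2.
  rewrite -cardG -sum1_card [in X in _ + X = _]big_mkcond -sum1_card -!big_split /=.
  by apply: eq_bigr => v _; rewrite inE; case: (f v : nat) => //= m; lia.
suff : #|Z| + (k.+1 %| n) <= \sum_v c v + (n %/ k.+1).*2 by lia.
have exE := excess_grid Z c.
case: (boolP (k.+1 %| n)) => [/dvdnP[[|q] nE]|_].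
- by lia.
- have -> : n %/ k.+1 = q.+1 by rewrite nE mulnK.
  by have := excess_bound_dvd cfg k0 nE; rewrite exE; lia.
by have := excess_bound cfg; rewrite exE; lia.
Qed.

(** * Optimal labelings *)

Section Construction.

Variables (k n : nat).
Hypotheses (k0 : 0 < k) (n0 : 0 < n).

Local Notation q := (n %/ k.+1).

(* Column [j] lies in block [j %/ k.+1]; a column divisible by [k.+1] also ends
   the previous block. *)
Definition block_label (r : bool) (j : nat) : nat :=
  let b := j %/ k.+1 in let p := odd (r + j + b) in
  if k.+1 %| j then nat_of_bool (if p then b == 0 else b == q)
  else if b == q then 1 else p.*2.

Definition block_labeling : labeling (grid2 n) k :=
  [ffun v : grid2 n => inord (block_label (v.1 == row_of true) v.2)].

Lemma max_degree_gt0 : 0 < max_degree (grid2 n).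
Proof.
pose u : grid2 n := (row_of false, Ordinal n0); pose v : grid2 n := (row_of true, Ordinal n0).
have uv : v \in neighbors u by rewrite inE grid_adjE eqxx orbT.
apply: leq_trans (leq_bigmax u); apply/card_gt0P; by exists v.
Qed.

Lemma block_labelingE (v : grid2 n) :
  block_labeling v = block_label (v.1 == row_of true) v.2 :> nat.
Proof.
rewrite ffunE inordK //; have := max_degree_gt0.
rewrite /block_label; case: ifP => _; last by case: ifP => _; [|case: odd => /=]; lia.
by rewrite ltnS (leq_trans (leq_b1 _)).
Qed.

Lemma weight_block_labeling :
  weight block_labeling + q.*2 = n.*2 + (k.+1 %| n).
Proof.
(* A column has sum 2, or 0 if it separates blocks; columns 0 and [q * k.+1] each regain 1, having
   no block on one side. *)
have col j : block_label false j + block_label true j + (k.+1 %| j).*2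
    = 2 + (j == 0) + (j == q * k.+1).
  rewrite /block_label !oddD !oddb.
  case: (boolP (k.+1 %| j)) => [/dvdnP[b ->]|nd].
    rewrite mulnK // muln_eq0 orbF eqn_pmul2r //.
    by case: (odd (b * k.+1)); case: (odd b) => /=; lia.
  have -> : (j == 0) = false by apply: contraNF nd => /eqP->.
  have -> : (j == q * k.+1) = false by apply: contraNF nd => /eqP->; rewrite dvdn_mull.
  by case: (_ == q); case: (odd j); case: (odd (j %/ _)).
have W : weight block_labeling = \sum_(j < n) (block_label false j + block_label true j).
  rewrite /weight; under eq_bigr => v _ do rewrite block_labelingE.
  rewrite big_split /= -(pair_bigA _ (fun (i : 'I_2) (j : 'I_n) => block_label (i == row_of true) j)) /=.
  by rewrite big_ord_recl big_ord1.
have T : weight block_labeling + (\sum_(j < n) (k.+1 %| j)).*2 = n.*2 + 1 + (q * k.+1 < n).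
  rewrite W -mul2n big_distrr -big_split /=.
  under eq_bigr => j _ do rewrite mul2n col.
  rewrite !big_split /= sum_nat_const card_ord -mul2n mulnC; congr (_ + _ + _).
    by rewrite (bigD1 (Ordinal n0)) //= big1 // => i; rewrite -val_eqE /= => /negPf->.
  case: (boolP (q * k.+1 < n)) => [qn|qn].
    by rewrite (bigD1 (Ordinal qn)) //= eqxx big1 // => i; rewrite -val_eqE /= => /negPf->.
  by rewrite big1 // => i _; case: eqP => // iE; have := ltn_ord i; lia.
have M m : \sum_(j < m.+1) (k.+1 %| j) = (m %/ k.+1).+1.
  rewrite big_ord_recl dvdn0 add1n divn_count_dvd big_add1 big_mkord.
  by congr (_.+1).
have := M n.-1; rewrite prednK // divn_pred => {}M.
have qn : (q * k.+1 < n) = (0 < n %% k.+1).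
  by rewrite [X in _ < X](divn_eq n k.+1) -[X in X < _]addn0 ltn_add2l.
have q0 : n %% k.+1 = 0 -> 0 < q.
  by move=> r0; have := divn_eq n k.+1; rewrite r0; case: (q) => //; lia.
move: T q0; rewrite M qn /dvdn; move: (weight _) (n %/ _) (n %% _) => w a r.
by case: r => [|r] /= T q0; [have := q0 erefl|]; lia.
Qed.

(* The columns of block [b] have positions [0, ..., k + 1]; those at both ends,
   shared with the adjacent blocks, contain a zero but no guard of the block. *)
Definition block_zero (b : nat) (r : bool) (j : nat) : bool :=
  [&& b < q, b * k.+1 <= j <= b.+1 * k.+1 & ~~ odd (r + j + b)].

Definition block_guard (b : nat) (r : bool) (j : nat) : bool :=
  [&& b < q, b * k.+1 < j < b.+1 * k.+1 & odd (r + j + b)].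

(** The term [b] in the parity makes the two zeros of a separating column belong to different
    blocks; the one of odd parity goes to the block on the left. *)
Definition zero_block (r : bool) (j : nat) : nat :=
  j %/ k.+1 - ((k.+1 %| j) && odd (r + j + j %/ k.+1)).

Lemma block_label_zero r j : j < n -> block_label r j = 0 ->
  block_zero (zero_block r j) r j.
Proof.
move=> jn; have jE := divn_eq j k.+1.
have bq : j %/ k.+1 <= q by apply: leq_div2r; apply: ltnW.
rewrite /block_label /zero_block /block_zero; move: jE.
have := ltn_pmod j (ltn0Sn k); rewrite /dvdn.
set b := j %/ k.+1 in bq *; set t := j %% k.+1 => tk jE.
case: (posnP t) => [t0|t0] /=; last first.
  rewrite subn0; case: eqP => // bqn; case: odd => // _.
  by rewrite andbT mulSn; lia.
case: (boolP (odd _)) => p /=.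
  case: b bq jE p => // b bq jE p _; rewrite subn1 /= mulSn.
  by move: p; rewrite addnS /= => ->; rewrite mulSn in jE; lia.
by case: eqP => // bqn _; rewrite subn0 p mulSn; lia.
Qed.

Lemma block_label_guard b r j : block_guard b r j -> block_label r j = 2.
Proof.
case/and3P=> bq /andP[lo hi] p.
have jE : j = b * k.+1 + (j - b * k.+1) by lia.
have small : j - b * k.+1 < k.+1 by move: hi; rewrite mulSn; lia.
have div : j %/ k.+1 = b by rewrite jE divnMDl // divn_small ?addn0.
rewrite /block_label div p /= /dvdn {1}jE modnMDl modn_small //.
by rewrite (ltn_eqF bq) (gtn_eqF (_ : 0 < _)) // subn_gt0.
Qed.

(** * Defence of the block labeling against one attack pattern *)

Variable P : {set grid2 n}.
Hypothesis cardP : #|P| = k.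

(* Not attacked if [j = n], the missing last column of the last block when
   [k.+1 %| n]. *)
Definition attacked (b j : nat) : bool :=
  [exists v in P, (v.2 == j :> nat) && block_zero b (v.1 == row_of true) j].

Definition attacked_left (b j : nat) : bool :=
  [forall i : 'I_j.+1, (b * k.+1 <= i) ==> attacked b i].

Definition attacked_right (b j : nat) : bool :=
  [forall i : 'I_(b.+1 * k.+1).+1, (j <= i) ==> attacked b i].

Lemma attacked_leftP b j :
  reflect (forall i, b * k.+1 <= i <= j -> attacked b i) (attacked_left b j).
Proof.
apply: (iffP forallP) => [H i /andP[bi ij]|H i].
  by have /implyP := H (Ordinal (ij : i < j.+1)); apply.
by apply/implyP => bi; apply: H; rewrite bi -ltnS ltn_ord.
Qed.

Lemma attacked_rightP b j :
  reflect (forall i, j <= i <= b.+1 * k.+1 -> attacked b i) (attacked_right b j).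
Proof.
apply: (iffP forallP) => [H i /andP[ji ib]|H i].
  by have /implyP := H (Ordinal (ib : i < (b.+1 * k.+1).+1)); apply.
by apply/implyP => ji; apply: H; rewrite ji -ltnS ltn_ord.
Qed.

Lemma size_attacked b (s : seq nat) : uniq s -> all (attacked b) s -> size s <= k.
Proof.
move=> us /allP sP; rewrite -cardP cardE -(size_map (fun v : grid2 n => v.2 : nat)).
apply: uniq_leq_size => // j /sP /exists_inP[v vP /andP[/eqP <- _]].
by apply/mapP; exists v => //; rewrite mem_enum.
Qed.

(* If all zeros of the block up to column [j] are attacked they are all defended
   from the right, and symmetrically; the remaining ones are defended by the
   guard of their column. At most [k] of the [k + 2] zeros of a block are
   attacked, so no guard is used twice. *)
Definition defence_column (b j : nat) : nat :=
  if attacked_left b j then j.+1 else if attacked_right b j then j.-1 else j.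

Lemma attacked_range b j : attacked b j -> b < q /\ b * k.+1 <= j <= b.+1 * k.+1.
Proof. by case/exists_inP => v _ /andP[_ /and3P[]]. Qed.

(** Moving into an end column would take a run of [k.+1] attacked zeros; an attacked zero in an end
    column is a full run by itself and is defended from inside the block. *)
Lemma defence_column_bounds b j : attacked b j ->
  b * k.+1 < defence_column b j < b.+1 * k.+1.
Proof.
move=> at_j; have [_ /andP[lo hi]] := attacked_range at_j; rewrite /defence_column.
case: (attacked_leftP b j) => [L|L].
  have /= := @size_attacked b (iota (b * k.+1) (j.+1 - b * k.+1)) (iota_uniq _ _).
  rewrite size_iota => H; rewrite mulSn.
  have : j.+1 - b * k.+1 <= k; last by lia.
  by apply: H; apply/allP => i; rewrite mem_iota => ?; apply: L; lia.
case: (attacked_rightP b j) => [R|R].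
  have /= := @size_attacked b (iota j ((b.+1 * k.+1).+1 - j)) (iota_uniq _ _).
  rewrite size_iota => H; rewrite mulSn in hi R H *.
  have : (k.+1 + b * k.+1).+1 - j <= k; last by lia.
  by apply: H; apply/allP => i; rewrite mem_iota => ?; apply: R; lia.
have jlo : j != b * k.+1.
  by apply: contra_notN L => /eqP jE i ij; rewrite (_ : i = j) //; lia.
have jhi : j != b.+1 * k.+1.
  by apply: contra_notN R => /eqP jE i ij; rewrite (_ : i = j) //; lia.
by lia.
Qed.

Lemma defence_column_inj b j j' : attacked b j -> attacked b j' ->
  defence_column b j = defence_column b j' -> j = j'.
Proof.
wlog jj : j j' / j < j'.
  by move=> H aj aj' e; case: (ltngtP j j') => // lt; [apply: H | apply/esym/H].
move=> aj aj' e; have := defence_column_bounds aj; have := defence_column_bounds aj'.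
have [_ /andP[lo _]] := attacked_range aj; have [_ /andP[_ hi']] := attacked_range aj'.
move: e; rewrite /defence_column.
case: (attacked_leftP b j) => [L|L]; case: (attacked_leftP b j') => [L'|L'].
- by lia.
- case: (attacked_rightP b j') => [R'|_] e _ _.
    (* Here [j.+1 = j'.-1], so all but one of the [k + 2] zeros of the block would be attacked. *)
    have := @size_attacked b (iota (b * k.+1) (j.+1 - b * k.+1) ++ iota j' ((b.+1 * k.+1).+1 - j')).
    rewrite size_cat !size_iota => H; exfalso.
    suff : j.+1 - b * k.+1 + ((b.+1 * k.+1).+1 - j') <= k by rewrite mulSn in hi' *; lia.
    apply: H.
      rewrite cat_uniq !iota_uniq andbT /=; apply/hasPn => i; rewrite !mem_iota.
      by move=> ?; apply/negP; lia.
    rewrite all_cat; apply/andP; split; apply/allP => i; rewrite mem_iota => ?.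
      by apply: L; lia.
    by apply: R'; lia.
  case: L' => i ij; case: (ltngtP i j') => [ilt|igt|->] //; last by lia.
  by apply: L; lia.
- by case: (attacked_rightP b j) => [R|R]; lia.
case: (attacked_rightP b j) => [R|R]; case: (attacked_rightP b j') => [R'|R'] e *; try lia.
case: R => i ij; case: (ltngtP i j) => [ilt|igt|->] //; first by lia.
by apply: R'; lia.
Qed.

(** A guard in the same column is in the other row, a guard in an adjacent column in the same row.
    For attacked zeros the column is interior to a block, so the default of [insubd] is not
    reached. *)
Definition defence : {ffun grid2 n -> grid2 n} :=
  [ffun u : grid2 n =>
    let r := u.1 == row_of true in
    let t := defence_column (zero_block r u.2) u.2 in
    (row_of (r (+) (t == u.2)), insubd u.2 t)].

Lemma grid_adj_coords (u v : grid2 n) :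
  adj u v = ((u.1 == row_of true) == (v.1 == row_of true))
              && ((v.2 == u.2.+1 :> nat) || (u.2 == v.2.+1 :> nat))
            || ((v.1 == row_of true) == ~~ (u.1 == row_of true))
              && (v.2 == u.2 :> nat).
Proof.
case: u v => [a i] [b j]; have [r ->] := row_ofP a; have [s ->] := row_ofP b.
by rewrite grid_adjE !row_of_eq [i == j]eq_sym; case: r; case: s.
Qed.

Lemma row_of_true (i : 'I_2) : row_of (i == row_of true) = i.
Proof. by have [r ->] := row_ofP i; rewrite row_of_eq; case: r. Qed.

Lemma defenceP (u : grid2 n) : u \in zeros_in block_labeling P ->
  exists b, [/\ attacked b u.2, block_zero b (u.1 == row_of true) u.2,
    block_guard b ((defence u).1 == row_of true) (defence u).2,
    (defence u).2 = defence_column b u.2 :> nat & defence u \in neighbors u].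
Proof.
rewrite inE block_labelingE => /andP[uP /eqP/block_label_zero]; move/(_ (ltn_ord _)).
set b := zero_block _ _ => zu; exists b.
have au : attacked b u.2 by apply/exists_inP; exists u; rewrite // eqxx.
have /andP[tlo thi] := defence_column_bounds au.
have [bq _] := attacked_range au.
have tn : defence_column b u.2 < n.
  apply: leq_trans thi _; apply: leq_trans (leq_trunc_div n k.+1).
  by rewrite leq_mul2r bq orbT.
have d2 : (defence u).2 = defence_column b u.2 :> nat.
  by rewrite ffunE /= val_insubd -/b tn.
have d1 : ((defence u).1 == row_of true) =
    ((u.1 == row_of true) (+) (defence_column b u.2 == u.2)).
  by rewrite ffunE /= -/b row_of_eq; case: (_ (+) _).
have near : [|| defence_column b u.2 == u.2, defence_column b u.2 == u.2.+1
              | u.2 == (defence_column b u.2).+1 :> nat].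
  move: tlo; rewrite /defence_column; case: ifP => _; [|case: ifP => _]; rewrite ?eqxx ?orbT //.
  by move=> ?; apply/orP; right; apply/orP; right; apply/eqP; lia.
split=> //.
- rewrite /block_guard bq d2 tlo thi d1 /=.
  case/and3P: zu => _ _; move: near; rewrite !oddD !oddb.
  case: eqP => [->|_] /=; first by case: (u.1 == _); case: (odd u.2); case: (odd b).
  move=> e; have -> : odd (defence_column b u.2) = ~~ odd u.2.
    by case/orP: e => /eqP e; [rewrite e | rewrite [in RHS]e /= negbK].
  by case: (u.1 == _); case: (odd u.2); case: (odd b).
move: near; rewrite inE grid_adj_coords d1 d2.
by case: (_ == row_of true); case: (_ == u.2 :> nat) => //=; rewrite orbF.
Qed.

Lemma defends_block_labeling : defends block_labeling P defence.
Proof.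
apply/andP; split; apply/forall_inP.
  move=> u /defenceP[b [_ _ gu _ ->]].
  by rewrite block_labelingE (block_label_guard gu).
move=> v _.
set F := [set _ in _ | _].
have [->|[u0]] := set_0Vmem F; first by rewrite cards0.
rewrite inE => /andP[/defenceP[b0 [_ _ g0 _ _]] /eqP d0].
rewrite block_labelingE -d0 (block_label_guard g0) subn1 /=.
apply/card_le1_eqP => u u'; rewrite ![_ \in F]in_set => /andP[zu /eqP du] /andP[zu' /eqP du'].
have [b [au zb gb cb _]] := defenceP zu; have [b' [au' zb' gb' cb' _]] := defenceP zu'.
rewrite du in gb cb; rewrite du' in gb' cb'.
(* The column of a guard determines its block, so zeros sharing the guard [v] lie in one block and
   [defence_column_inj] applies. *)
have div c : block_guard c (v.1 == row_of true) v.2 -> c = v.2 %/ k.+1.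
  move=> /and3P[_ /andP[lo hi] _]; apply/eqP; rewrite eqn_leq leq_divRL // ltnW //=.
  by rewrite -ltnS ltn_divLR.
have bb : b' = b by rewrite (div _ gb) (div _ gb').
rewrite {}bb in au' zb' cb'.
have uu : u.2 = u'.2.
  by apply/val_inj/(defence_column_inj au au'); rewrite -cb -cb'.
have rr : (u.1 == row_of true) = (u'.1 == row_of true).
  case/and3P: zb => _ _; case/and3P: zb' => _ _; rewrite uu !oddD !oddb.
  by case: (u.1 == _); case: (u'.1 == _); case: (odd u'.2); case: (odd b).
rewrite (surjective_pairing u) (surjective_pairing u') uu.
by rewrite -(row_of_true u.1) -(row_of_true u'.1) rr.
Qed.

End Construction.

(** * The exact value and the ceiling formula *)

Lemma kSRD_number_grid2 (k n : nat) : 0 < k -> 0 < n -> k <= n.*2 ->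
  kSRD_number (grid2 n) k + (n %/ k.+1).*2 = n.*2 + (k.+1 %| n).
Proof.
move=> k0 n0 kn; apply/eqP; rewrite eqn_leq; apply/andP; split.
  rewrite -(weight_block_labeling k0 n0) leq_add2r; apply: kSRD_number_min.
  apply/forall_inP => P /eqP cardP; apply/existsP; exists (defence k P).
  exact: defends_block_labeling.
by have [f fP <-] := kSRD_number_attained (grid2 n) k; apply: weight_ge.
Qed.

Lemma ceil_div (a b : nat) (m : int) : 0 < b ->
  ((m - 1) * b%:Z < a%:Z <= m * b%:Z)%R -> Num.ceil (a%:R / b%:R : rat)%R = m.
Proof.
move=> b0 /andP[lo hi]; have b0R : (0 < b%:R :> rat)%R by rewrite ltr0n.
have le : (Num.ceil (a%:R / b%:R : rat) <= m)%R.
  by rewrite ceil_le_int ler_pdivrMr // !pmulrn -intrM ler_int.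
have gt : (m - 1 < Num.ceil (a%:R / b%:R : rat))%R.
  by rewrite ceil_gt_int ltr_pdivlMr // !pmulrn -intrM ltr_int.
by lia.
Qed.

(** Such an [r] lies strictly between 0 and [k.+1], so it is the remainder itself. *)
Lemma residue_lt_half (k n : nat) :
  (exists r : int, [/\ 0 < r, r%:~R < (k%:R + 1) / 2 :> rat
     & (n%:Z = r %[mod k%:Z + 1])%Z])%R <-> 0 < n %% k.+1 /\ (n %% k.+1).*2 < k.+1.
Proof.
have half (r : int) : (r%:~R < (k%:R + 1) / 2 :> rat)%R = (r * 2 < k.+1%:Z)%R.
  rewrite ltr_pdivlMr // natr1 (_ : 2 = (2%:Z)%:~R)%R // -intrM.
  by rewrite (_ : k.+1%:R = (k.+1%:Z)%:~R)%R // ltr_int.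
have kE : (k%:Z + 1 = k.+1%:Z)%R by lia.
split=> [[r [r0]]|[r0 rk]].
  rewrite half kE => rk e; have rE : r = Posz (n %% k.+1).
    by rewrite -modz_nat e modz_small //; lia.
  by lia.
exists (Posz (n %% k.+1)); split; rewrite ?half ?kE; try lia.
by rewrite -modz_nat modz_mod.
Qed.

Local Open Scope ring_scope.

Theorem theorem5 (k n : nat) (hk : (2 <= k)%N) (hn : (0 < n)%N)
    (hkn : k%:R / 2 <= n%:R :> rat) :
  ((exists r : int,
      [/\ 0 < r, r%:~R < (k%:R + 1) / 2 :> rat
        & (n%:Z = r %[mod k%:Z + 1])%Z]) ->
   (kSRD_number (grid2 n) k)%:Z = Num.ceil ((2 * k%:R * n%:R) / (k%:R + 1) : rat))
  /\
  (~ (exists r : int,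
      [/\ 0 < r, r%:~R < (k%:R + 1) / 2 :> rat
        & (n%:Z = r %[mod k%:Z + 1])%Z]) ->
   (kSRD_number (grid2 n) k)%:Z =
     Num.ceil ((2 * k%:R * n%:R) / (k%:R + 1) : rat) + 1).
Proof.
have kn : (k <= n.*2)%N.
  by move: hkn; rewrite ler_pdivrMr // -natrM ler_nat muln2.
have := residue_lt_half k n; set residue := (exists r : int, _) => residueE.
have := @kSRD_number_grid2 k n (ltnW hk) hn kn; rewrite /dvdn.
rewrite -!natrM natr1; move: residueE.
have := divn_eq n k.+1; have := ltn_pmod n (ltn0Sn k).
move: (kSRD_number _ _) (n %/ _)%N (n %% _)%N => K q r rk nE residueE KE.
(* 2kn/(k+1) = 2n - 2q - 2r/(k+1), where the last fraction is below 2, and at least 1 exactly if k <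
   2r. *)
pose m : int := n.*2%:Z - q.*2%:Z - (k < r.*2)%:Z.
rewrite (@ceil_div _ _ m) //; last first.
  have -> : (2 * k * n)%:Z = (n.*2%:Z - q.*2%:Z) * k.+1%:Z - r.*2%:Z.
    by rewrite nE; lia.
  by rewrite /m; case: (boolP (k < r.*2)%N) => kr; lia.
rewrite /m; split.
  case/residueE => r0 kr; move: KE.
  by rewrite eqn0Ngt r0 (_ : (k < r.*2)%N = false); lia.
move=> Nres; case: (posnP r) KE => [-> KE|r0 KE]; first by lia.
case: (boolP (k < r.*2)%N) => kr; first by lia.
by case: Nres; apply/residueE; split=> //; lia.
Qed.
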